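(* Let $\gamma$ be a simple zero of a sufficiently differentiable function $f\colon \mathbf{D}\subset\mathbf{R}\to\mathbf{R}$ in an open interval $\mathbf{D}$. Consider the iterative method which, from $x_n$, computes, for $n=0,1,2,\ldots$, $$y_n = x_n - \frac{f(x_n)}{f'(x_n)},\qquad z_n = y_n - \frac{f(y_n)}{2\left(\dfrac{f(y_n)-f(x_n)}{y_n-x_n}\right)-f'(x_n)},\qquad x_{n+1} = z_n - \frac{(x_n-y_n)^2(y_n-z_n)(x_n-z_n)\,f(z_n)}{B_n},$$ where $$B_n = (y_n-z_n)^2(x_n-z_n)(x_n-y_n)f'(x_n) - (x_n-y_n)^2(2y_n-3z_n+x_n)f(z_n) + (x_n-z_n)^3f(y_n) - (y_n-z_n)^2(3x_n-2y_n-z_n)f(x_n).$$ If $x_0$ is sufficiently close to $\gamma$, then the convergence order of this method is $8$, and the error equation for the method is $$e_{n+1} = -\frac{c_2^2\left(c_3c_1^3c_4-c_4c_1^2c_2^2-c_3^2c_1^2c_2+2c_3c_1c_2^3-c_2^5\right)}{c_1^7}\,e_n^8+O\left(e_n^9\right),$$ where $e_n = x_n-\gamma$ and $c_m = f^{(m)}(\gamma)/m!$ for $m\ge 1$.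
   Context: A simple zero $\gamma$ of $f$ is a point with $f(\gamma)=0$ and $f'(\gamma)\neq 0$. Here $f^{(m)}$ denotes the $m$-th derivative of $f$. The convergence order $\xi$ of an iterative method is defined by $\lim_{n\to\infty}\dfrac{|e_{n+1}|}{|e_n|^{\xi}} = c\neq 0$, where $e_n=x_n-\gamma$. The error equation expresses the error $e_{n+1}$ after one step in terms of the error $e_n$ before it, as $e_n\to 0$.
   Formalization: The claim that the convergence order is 8 is made only when x_0 ≠ γ and the displayed coefficient of e_n^8 is nonzero; otherwise (e.g. f(x) = x) the limit defining the order is zero or undefined. *)

(* Defs.v *)
From mathcomp Require Import all_boot all_order all_algebra.
From mathcomp Require Import all_classical all_reals all_analysis.
Set Implicit Arguments.
Unset Strict Implicit.
Unset Printing Implicit Defensive.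
Import Order.TTheory GRing.Theory Num.Theory.
Import numFieldNormedType.Exports.
Local Open Scope classical_set_scope.
Local Open Scope ring_scope.

(* A function D -> R on an open set D is represented by a total f : R -> R;
   the derivatives of f at points of D depend only on the values of f on D. *)
Definition differentiable_times (R : realType) (k : nat) (D : set R)
    (f : R -> R) : Prop :=
  forall (j : nat) (x : R), (j < k)%N -> D x -> derivable (derive1n j f) x 1.

Definition simple_zero (R : realType) (f : R -> R) (gamma : R) : Prop :=
  f gamma = 0 /\ derive1 f gamma != 0.

Definition taylor_coef (R : realType) (f : R -> R) (a : R) (m : nat) : R :=
  derive1n m f a / m`!%:R.

Definition y_of (R : realType) (f : R -> R) (x : R) : R :=
  x - f x / derive1 f x.

Definition z_denom (R : realType) (f : R -> R) (x y : R) : R :=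
  2 * ((f y - f x) / (y - x)) - derive1 f x.

Definition z_of (R : realType) (f : R -> R) (x : R) : R :=
  let y := y_of f x in y - f y / z_denom f x y.

Definition B_of (R : realType) (f : R -> R) (x y z : R) : R :=
  (y - z) ^+ 2 * (x - z) * (x - y) * derive1 f x
  - (x - y) ^+ 2 * (2 * y - 3 * z + x) * f z
  + (x - z) ^+ 3 * f y
  - (y - z) ^+ 2 * (3 * x - 2 * y - z) * f x.

(* Division is total with t / 0 = 0, so an iterate that lands exactly on a
   zero of f stays there; see step_well_defined for the genuine denominators. *)
Definition step (R : realType) (f : R -> R) (x : R) : R :=
  let y := y_of f x in
  let z := z_of f x in
  z - (x - y) ^+ 2 * (y - z) * (x - z) * f z / B_of f x y z.

Definition iterate (R : realType) (f : R -> R) (x0 : R) (n : nat) : R :=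
  iter n (step f) x0.

(* All points where f is evaluated lie in D and no denominator vanishes,
   unless a zero of f has already been reached: f x = 0 gives y = x, and
   f y = 0 gives z = y, where the remaining quotients have the form 0 / 0. *)
Definition step_well_defined (R : realType) (D : set R) (f : R -> R) (x : R)
    : Prop :=
  let y := y_of f x in
  let z := z_of f x in
  [/\ [/\ D x, D y & D z],
      derive1 f x != 0,
      f x != 0 -> y - x != 0 /\ z_denom f x y != 0
    & f x != 0 -> f y != 0 -> B_of f x y z != 0].

Definition has_convergence_order (R : realType) (x : nat -> R) (gamma xi : R)
    : Prop :=
  x @ \oo --> gamma /\
  exists c : R, c != 0 /\
    (fun n => `|x n.+1 - gamma| / `|x n - gamma| `^ xi) @ \oo --> c.

Definition error_constant (R : realType) (f : R -> R) (gamma : R) : R :=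
  let c1 := taylor_coef f gamma 1 in
  let c2 := taylor_coef f gamma 2 in
  let c3 := taylor_coef f gamma 3 in
  let c4 := taylor_coef f gamma 4 in
  - (c2 ^+ 2 * (c3 * c1 ^+ 3 * c4 - c4 * c1 ^+ 2 * c2 ^+ 2
                - c3 ^+ 2 * c1 ^+ 2 * c2 + 2 * c3 * c1 * c2 ^+ 3
                - c2 ^+ 5)) / c1 ^+ 7.

(* Main.v *)
(* Write u, v, w for the errors of x, y, z. A Taylor expansion of order 4 of f
   with relative remainder O(u) is enough, provided powers of u and v are
   cancelled exactly rather than estimated:
     v = u^2 a          with a = c2/c1 + O(u),
     w = v u^2 b        with b = (c2^2/c1 - c3)/c1 + O(u).
   The last step is a Newton step at z in which f'(z) is replaced by the
   derivative h = f'(z) + c4 u^2 v + ... of a Hermite interpolant, so that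
     w - f(z)/h = (c2 w^2 + c4 u^2 v w + ...)/c1 = u^8 a^2 b (c2 b + c4 + O(u))/c1.
   The case v = 0 (where B_n = 0) is harmless: then w = 0 too. *)

Require Import Defs.
From mathcomp Require Import all_boot all_order all_algebra.
From mathcomp Require Import all_classical all_reals all_analysis.
From mathcomp Require Import ring.
Import Order.TTheory GRing.Theory Num.Theory.
Import numFieldNormedType.Exports.
Local Open Scope classical_set_scope.
Local Open Scope ring_scope.

(** * Functions equal to l + O(u) at 0 *)

(** An explicit rate instead of a bare limit: the final $O(e_n^9)$ comes from a factor lying within
    $O(u)$ of its limit. The neighbourhood is not punctured, so [g 0 = l]. *)
Definition lin_cvg {R : realType} (g : R -> R) (l : R) : Prop :=
  exists M : R, \forall u \near (0 : R), `|g u - l| <= M * `|u|.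

Section LinCvg.
Context {R : realType}.
Implicit Types (g h : R -> R) (l m : R).

Lemma lin_cvg_ge0 g l : lin_cvg g l ->
  exists2 M : R, 0 <= M & \forall u \near (0 : R), `|g u - l| <= M * `|u|.
Proof.
case=> M gl; exists `|M| => //; near=> u.
have gu : `|g u - l| <= M * `|u| by near: u.
by apply: le_trans gu _; rewrite ler_wpM2r // ler_norm.
Unshelve. all: by end_near. Qed.

Lemma lin_cvg_cvg g l : lin_cvg g l -> g u @[u --> 0] --> l.
Proof.
move=> /lin_cvg_ge0[M M0 gl]; have M1 : 0 < M + 1 by rewrite ltr_wpDl.
apply/cvgrPdist_le => /= e e0; near=> u.
have gu : `|g u - l| <= M * `|u| by near: u.
rewrite distrC; apply: le_trans gu _.
have ue : `|u| <= e / (M + 1)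
  by near: u; apply: (@nbhs0_le R R); rewrite divr_gt0 //.
apply: (@le_trans _ _ ((M + 1) * (e / (M + 1)))); last first.
  by rewrite mulrC divfK // gt_eqF.
by apply: ler_pM => //; rewrite lerDl.
Unshelve. all: by end_near. Qed.

Lemma lin_cvg_neq0 g l : lin_cvg g l -> l != 0 ->
  \forall u \near (0 : R), g u != 0.
Proof. by move=> /lin_cvg_cvg gl l0; exact: cvgr_neq0 gl l0. Qed.

Lemma lin_cvg_cst l : lin_cvg (R := R) (fun=> l) l.
Proof.
by exists 0; near=> u; rewrite subrr normr0 mul0r.
Unshelve. all: by end_near. Qed.

Lemma lin_cvg_id : lin_cvg (R := R) id 0.
Proof.
by exists 1; near=> u; rewrite subr0 mul1r.
Unshelve. all: by end_near. Qed.

Lemma lin_cvgN g l : lin_cvg g l -> lin_cvg (fun u => - g u) (- l).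
Proof.
by case=> M gl; exists M; apply: filterS gl => u; rewrite -opprD normrN.
Qed.

Lemma lin_cvgD g h l m : lin_cvg g l -> lin_cvg h m ->
  lin_cvg (fun u => g u + h u) (l + m).
Proof.
move=> [M gl] [N hm]; exists (M + N); near=> u.
rewrite opprD addrACA mulrDl (le_trans (ler_normD _ _)) // lerD //; near: u.
- exact: gl.
- exact: hm.
Unshelve. all: by end_near. Qed.

Lemma lin_cvgM g h l m : lin_cvg g l -> lin_cvg h m ->
  lin_cvg (fun u => g u * h u) (l * m).
Proof.
move=> /lin_cvg_ge0[M M0 gl] /lin_cvg_ge0[N N0 hm].
exists (M * (`|m| + N) + `|l| * N); near=> u.
have gu : `|g u - l| <= M * `|u| by near: u.
have hu : `|h u - m| <= N * `|u| by near: u.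
have u1 : `|u| <= 1 by near: u; exact: (@nbhs0_le R R _ ltr01).
have hb : `|h u| <= `|m| + N.
  rewrite -[h u](subrK m) addrC (le_trans (ler_normD _ _)) // lerD2l.
  by rewrite (le_trans hu) // ler_piMr.
have -> : g u * h u - l * m = (g u - l) * h u + l * (h u - m) by ring.
rewrite (le_trans (ler_normD _ _)) // !normrM mulrDl lerD //.
  by rewrite mulrAC ler_pM.
by rewrite -mulrA ler_wpM2l.
Unshelve. all: by end_near. Qed.

Lemma lin_cvgV g l : l != 0 -> lin_cvg g l ->
  lin_cvg (fun u => (g u)^-1) l^-1.
Proof.
move=> l0 gl; have [M M0 Mgl] := lin_cvg_ge0 _ _ gl.
have l20 : 0 < `|l| / 2 by rewrite divr_gt0 ?normr_gt0.
have lb : `|l| / 2 < `|l| by rewrite ltr_pdivrMr // ltr_pMr ?normr_gt0 // ltr1n.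
have gl2 : \forall u \near (0 : R), `|l| / 2 <= `|g u|.
  exact: cvgr_norm_ge l (lin_cvg_cvg g l gl) _ lb.
exists (M / (`|l| / 2 * `|l|)); near=> u.
have gu : `|g u - l| <= M * `|u| by near: u.
have gu0 : g u != 0 by near: u; exact: (lin_cvg_neq0 _ _ gl l0).
have gul2 : `|l| / 2 <= `|g u| by near: u.
have -> : (g u)^-1 - l^-1 = (l - g u) / (g u * l) by field; rewrite l0 gu0.
rewrite normrM normfV normrM distrC mulrAC.
rewrite ler_pM // ?invr_ge0 //.
rewrite lef_pV2 ?posrE ?mulr_gt0 ?normr_gt0 //.
by rewrite ler_wpM2r.
Unshelve. all: by end_near. Qed.

Lemma lin_cvgX g l n : lin_cvg g l -> lin_cvg (fun u => g u ^+ n) (l ^+ n).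
Proof.
move=> gl; elim: n => [|n IHn]; first exact: lin_cvg_cst.
under [X in lin_cvg X]eq_fun do rewrite exprS.
by rewrite exprS; exact: lin_cvgM.
Qed.

(** Serves to evaluate Taylor remainders at the errors of y and z, which are themselves functions of
    [u]. *)
Lemma lin_cvg_comp g h l : lin_cvg g l -> lin_cvg h 0 ->
  lin_cvg (fun u => g (h u)) l.
Proof.
move=> /lin_cvg_ge0[M M0 gl] h0; have [N N0 hN] := lin_cvg_ge0 _ _ h0.
exists (M * N); near=> u.
have hu : `|h u - 0| <= N * `|u| by near: u.
have ghu : `|g (h u) - l| <= M * `|h u|.
  by near: u; exact: (lin_cvg_cvg _ _ h0 _ gl).
by rewrite (le_trans ghu) // -mulrA ler_wpM2l // -[h u]subr0.
Unshelve. all: by end_near. Qed.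

End LinCvg.

(** * Taylor expansion *)

Section Taylor.
Context {R : realType}.
Implicit Types (f : R -> R) (a : R).

(** The mean value theorem writes [phi x] as [dphi c * (x - a)] with [c] between [a] and [x], which
    gains one power of the distance. *)
Lemma near_mean_value_bound (phi dphi : R -> R) (a M : R) (n : nat) :
  phi a = 0 ->
  (\forall x \near a, is_derive x (1 : R) phi (dphi x)) ->
  (\forall x \near a, `|dphi x| <= M * `|x - a| ^+ n) ->
  \forall x \near a, `|phi x| <= M * `|x - a| ^+ n.+1.
Proof.
move=> phia0 dphiP dphiM.
have [e /= e0 eP] : nbhs a [set x | is_derive x (1 : R) phi (dphi x) /\
   `|dphi x| <= M * `|x - a| ^+ n] by near=> x; split; near: x.
exists e => //= x xe.
have in_ball c : Num.min a x <= c <= Num.max a x -> ball a e c.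
  move: xe; rewrite /ball /= => xe.
  case: (leP a x) => ax /andP[ac cx]; apply: le_lt_trans xe.
    by rewrite distrC [leRHS]distrC !ger0_norm ?subr_ge0 // lerB.
  by rewrite !ger0_norm ?subr_ge0 // ?lerB // ltW.
have [c cP phiE] : exists2 c, Num.min a x <= c <= Num.max a x &
    phi x = dphi c * (x - a).
  have aux (p q : R) : p <= q -> (forall c, p <= c <= q -> ball a e c) ->
      exists2 c, p <= c <= q & phi q - phi p = dphi c * (q - p).
    move=> pq pqe.
    have [||c] := @MVT_segment _ phi dphi _ _ pq.
    - by move=> c; rewrite in_itv /= => /andP[/ltW pc /ltW cq];
         apply: (eP c _).1; apply: pqe; rewrite pc.
    - apply: derivable_within_continuous => c; rewrite in_itv /= => /pqe ce.
      by have [[]] := eP c ce.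
    - by rewrite in_itv /= => cpq h; exists c.
  case: (leP a x) in_ball => ax in_ball.
    by have [c ? h] := aux _ _ ax in_ball; exists c; rewrite // -h phia0 subr0.
  have [c ? h] := aux _ _ (ltW ax) in_ball; exists c => //.
  by rewrite -opprB mulrN -h phia0 sub0r opprK.
have ca : `|c - a| <= `|x - a|.
  case: (leP a x) cP => ax /andP[h1 h2].
    by rewrite !ger0_norm ?subr_ge0 // lerB.
  by rewrite distrC [leRHS]distrC !ger0_norm ?subr_ge0 // ?lerB // ltW.
have [_ cM] := eP c (in_ball c cP).
have [->|xa] := eqVneq x a; first by rewrite phia0 subrr !normr0 exprS mul0r mulr0.
rewrite phiE normrM exprSr mulrA ler_wpM2r // (le_trans cM) //.
(* [M] has no assumed sign, but for [n > 0] monotonicity of the powers needs [0 <= M]. The bound on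
   [dphi] at a point other than [a], either [x] or [c], supplies it. *)
have [->|n0] := posnP n; first by rewrite !expr0.
have [cea|ca0] := eqVneq c a.
  have M0 : 0 <= M.
    have [_] := eP x xe => /(le_trans (normr_ge0 _)).
    by rewrite pmulr_lge0 // exprn_gt0 // normr_gt0 subr_eq0.
  by rewrite ler_wpM2l // lerXn2r // nnegrE.
rewrite ler_wpM2l //; last by rewrite lerXn2r // nnegrE.
move: cM => /(le_trans (normr_ge0 _)).
by rewrite pmulr_lge0 // exprn_gt0 // normr_gt0 subr_eq0.
Unshelve. all: by end_near. Qed.

Lemma taylor_coef_derive1 f a k :
  taylor_coef (derive1 f) a k = k.+1%:R * taylor_coef f a k.+1.
Proof.
rewrite /taylor_coef -derive1Sn factS natrM.
by field; rewrite nat1r !pnatr_eq0 -lt0n fact_gt0.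
Qed.

(** Induction through [derive1 f], whose Taylor polynomial is the derivative of that of [f]; the
    mean value bound then integrates the estimate. The base case is boundedness of the difference
    quotient at [a]. *)
Lemma taylor_bound n f a :
  (forall j, (j <= n)%N -> \forall x \near a, derivable (derive1n j f) x 1) ->
  exists M, \forall x \near a,
    `|f x - (\poly_(k < n.+1) taylor_coef f a k).[x - a]| <=
      M * `|x - a| ^+ n.+1.
Proof.
elim: n f => [|n IHn] f fd.
  have fa : derivable f a 1 by have := nbhs_singleton (fd 0 isT).
  have [M Mphi] : exists M, \forall h \near 0^', `|h^-1 *: (f (h + a) - f a)| <= M.
    exists (`|'D_1 f a| + 1).
    have : (fun h => h^-1 *: (f (h + a) - f a)) @ 0^' --> 'D_1 f a.
      rewrite /derive; under eq_fun do rewrite -[X in X + a]mulr1.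
      exact: fa.
    by move=> /cvgr_norm_le; apply; rewrite ltrDl.
  exists M; apply/nbhs0P; move: Mphi; rewrite /dnbhs /within /= => Mphi.
  near=> h.
  have hM : h != 0 -> `|h^-1 *: (f (h + a) - f a)| <= M by near: h.
  rewrite horner_poly big_ord_recl big_ord0.
  rewrite /taylor_coef derive1n0 divr1 expr0 mulr1 addr0.
  rewrite [a + h]addrC addrK expr1.
  have [->|h0] := eqVneq h 0.
    by rewrite add0r subrr normr0 mulr0.
  have := hM h0; rewrite normrZ normfV.
  by rewrite mulrC ler_pdivrMr ?normr_gt0.
pose c := taylor_coef f a; pose q := \poly_(k < n.+2) c k.
have [M fM] : exists M, \forall x \near a,
    `|derive1 f x - (\poly_(k < n.+1) taylor_coef (derive1 f) a k).[x - a]| <=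
      M * `|x - a| ^+ n.+1.
  by apply: IHn => j jn; rewrite -derive1Sn; exact: fd.
exists M; apply: (@near_mean_value_bound _
  (fun x => derive1 f x - q^`().[x - a])).
- rewrite subrr horner_poly big_ord_recl /= big1 => [|i _].
    by rewrite expr0 mulr1 /c /taylor_coef derive1n0 divr1 addr0 subrr.
  by rewrite expr0n mulr0.
- near=> x.
  have fx : derivable f x 1 by near: x; exact: (fd 0).
  apply: is_deriveB.
    by rewrite derive1E; exact: derivableP.
  rewrite -[q^`().[x - a]]mulr1.
  apply: (@is_derive1_comp _ (horner q) (fun x => x - a)).
    exact: is_derive_poly.
  have := is_deriveD (is_derive_id x (1 : R)) (is_derive_cst (- a) x (1 : R)).
  by rewrite addr0; apply.
have -> : q^`() = \poly_(k < n.+1) taylor_coef (derive1 f) a k.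
  apply/polyP => i; rewrite coef_deriv !coef_poly ltnS; case: ltnP => // _.
    by rewrite taylor_coef_derive1 mulr_natl.
  by rewrite mul0rn.
exact: fM.
Unshelve. all: by end_near. Qed.

(** The error is $O(u^{n+2})$ but is divided by [u ^+ n.+1] only, so [rho] keeps a factor $O(u)$. At
    [u = 0] total division gives [rho 0 = 0]. *)
Lemma taylor_expansion n f a :
  (forall j, (j <= n.+1)%N ->
     \forall x \near a, derivable (derive1n j f) x 1) ->
  exists2 rho, lin_cvg rho 0 & \forall u \near (0 : R),
    f (a + u) =
    (\poly_(k < n.+2) taylor_coef f a k).[u] + u ^+ n.+1 * rho u.
Proof.
move=> /taylor_bound[M fM]; set p := \poly_(k < n.+2) _ in fM *.
pose rho u := (f (a + u) - p.[u]) / u ^+ n.+1.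
exists rho.
  exists `|M|; have /nbhs0P := fM; apply: filterS => u.
  rewrite [a + u]addrC addrK => fu.
  have [->|u0] := eqVneq u 0.
    by rewrite /rho expr0n invr0 mulr0 subrr normr0 mulr0.
  rewrite /rho subr0 normrM normfV ler_pdivrMr ?normr_gt0 ?expf_neq0 //.
  rewrite -mulrA normrX -exprS [a + u]addrC (le_trans fu) //.
  by rewrite ler_wpM2r ?exprn_ge0 // ler_norm.
near=> u; have [->|u0] := eqVneq u 0; last first.
  by rewrite [_ * rho _]mulrC divfK ?expf_neq0 // [RHS]addrC subrK.
rewrite expr0n mul0r addr0 addr0 /p horner_poly big_ord_recl big1 => [|i _].
  by rewrite expr0 mulr1 /taylor_coef derive1n0 divr1 addr0.
by rewrite expr0n mulr0.
Unshelve. all: by end_near. Qed.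

End Taylor.

(** * Exact error identities at a point *)

Section PointwiseIdentities.
Context {F : fieldType}.
Variables (c1 c2 c3 c4 : F).

(** Taylor expansion at the zero, hence without constant term. The relative remainder is a free
    scalar, which turns the identities below into field algebra. *)
Definition quartic (r t : F) : F :=
  c1 * t + c2 * t ^+ 2 + c3 * t ^+ 3 + c4 * t ^+ 4 + t ^+ 4 * r.

(** [s] is independent of the remainder in [quartic]: a bound on a remainder gives none on its
    derivative, so f' is expanded separately. *)
Definition quartic_deriv (s t : F) : F :=
  c1 + 2 * c2 * t + 3 * c3 * t ^+ 2 + 4 * c4 * t ^+ 3 + t ^+ 3 * s.

Definition newton_coef (r0 s u : F) : F :=
  (c2 + 2 * c3 * u + 3 * c4 * u ^+ 2 + u ^+ 2 * (s - r0)) /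
  quartic_deriv s u.

(** The terms in [c1] cancel in $u f' - f$, and [u ^+ 2] divides the rest. *)
Lemma newton_stepE (r0 s u : F) : quartic_deriv s u != 0 ->
  u - quartic r0 u / quartic_deriv s u = u ^+ 2 * newton_coef r0 s u.
Proof. by rewrite /newton_coef /quartic /quartic_deriv => d0; field. Qed.

(* The quotient (f y - f x) / (y - x) has u = x - gamma as a common factor of
   numerator and denominator once y = gamma + u ^ 2 * a; it is cancelled here. *)
Definition ostrowski_rem (r0 r1 u a : F) : F :=
  (u ^+ 4 * a ^+ 4 * r1 - r0) / (u * a - 1).

(** The symmetric sums in [u] and [v] are the divided differences of the powers of t. *)
Definition ostrowski_denom (r0 r1 s u a : F) : F :=
  let v := u ^+ 2 * a in
  2 * (c1 + c2 * (u + v) + c3 * (u ^+ 2 + u * v + v ^+ 2)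
       + c4 * (u ^+ 3 + u ^+ 2 * v + u * v ^+ 2 + v ^+ 3)
       + u ^+ 3 * ostrowski_rem r0 r1 u a) - quartic_deriv s u.

Definition ostrowski_coef (r0 r1 s u a : F) : F :=
  (c2 * a + c3 * (- 1 + 2 * u * a + u ^+ 2 * a ^+ 2)
   + c4 * (- 2 * u + 2 * u ^+ 2 * a + 2 * u ^+ 3 * a ^+ 2 + u ^+ 4 * a ^+ 3)
   + 2 * u * ostrowski_rem r0 r1 u a - u * s - u ^+ 4 * a ^+ 3 * r1) /
  ostrowski_denom r0 r1 s u a.

Lemma ostrowski_denomE (r0 r1 s u a : F) : u != 0 -> u * a - 1 != 0 ->
  2 * ((quartic r1 (u ^+ 2 * a) - quartic r0 u) / (u ^+ 2 * a - u))
    - quartic_deriv s u = ostrowski_denom r0 r1 s u a.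
Proof.
move=> u0 ua; rewrite /ostrowski_denom /ostrowski_rem /quartic.
have -> : u ^+ 2 * a - u = u * (u * a - 1) by ring.
by field; rewrite u0 ua.
Qed.

(** In [v] times the denominator minus f(y), the terms in [c1] cancel and $v u^2$ factors out of the
    rest. *)
Lemma ostrowski_stepE (r0 r1 s u a : F) :
  ostrowski_denom r0 r1 s u a != 0 ->
  u ^+ 2 * a - quartic r1 (u ^+ 2 * a) / ostrowski_denom r0 r1 s u a =
  u ^+ 2 * a * (u ^+ 2 * ostrowski_coef r0 r1 s u a).
Proof.
move=> D0; apply: (mulIf D0); rewrite mulrBl divfK // /ostrowski_coef.
rewrite -[RHS]mulrA -[X in _ = _ * X]mulrA (divfK D0).
rewrite /ostrowski_denom /quartic /quartic_deriv.
move: (ostrowski_rem _ _ _ _) => q.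
by ring.
Qed.

(* Contribution of the Taylor remainders to the derivative at z of the Hermite
   interpolant, divided by u ^ 2 * v: cancelling v = y - gamma as well keeps
   the estimates valid when c2 = 0, where v is smaller than u ^ 2. *)
Definition hermite_rem (r0 r1 r2 s u a b : F) : F :=
  let al := 1 - u * a in
  let be := 1 - u ^+ 2 * b in
  let ka := 1 - u ^+ 3 * a * b in
  let v := u ^+ 2 * a in
  be * s / al + u ^+ 2 * a ^+ 2 * ka ^+ 2 * r1 / (al ^+ 2 * be)
  - r2 * b ^+ 4 * (2 * v ^+ 3 * u ^+ 5 / ka + v ^+ 2 * u ^+ 6 / be)
  - be * (3 - 2 * u * a - u ^+ 3 * a * b) * r0 / (al ^+ 2 * ka).

Definition hermite_deriv (r0 r1 r2 s u a b : F) : F :=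
  let v := u ^+ 2 * a in
  let w := v * (u ^+ 2 * b) in
  c1 + 2 * c2 * w + 3 * c3 * w ^+ 2
  + c4 * (4 * w ^+ 3
          + u ^+ 2 * v * (1 - u ^+ 3 * a * b) ^+ 2 * (1 - u ^+ 2 * b))
  + v * u ^+ 2 * hermite_rem r0 r1 r2 s u a b.

Definition hermite_coef (r0 r1 r2 s u a b : F) : F :=
  let w := u ^+ 2 * a * (u ^+ 2 * b) in
  c2 * b + 2 * c3 * b * w + 3 * c4 * b * w ^+ 2
  + c4 * (1 - u ^+ 3 * a * b) ^+ 2 * (1 - u ^+ 2 * b)
  + hermite_rem r0 r1 r2 s u a b - b * w ^+ 2 * r2.

(* B_n is (x-y)^2 (y-z) (x-z) times the derivative at z of the cubic p with
   p = f at x, y, z and p' = f' at x. Hence it is exact on cubics, and on the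
   quartic term it misses (z-x)^2 (z-y). *)
Lemma hermite_denomE (r0 r1 r2 s u a b : F) :
  let v := u ^+ 2 * a in
  let w := v * (u ^+ 2 * b) in
  1 - u * a != 0 -> 1 - u ^+ 2 * b != 0 -> 1 - u ^+ 3 * a * b != 0 ->
  (v - w) ^+ 2 * (u - w) * (u - v) * quartic_deriv s u
  - (u - v) ^+ 2 * (2 * v - 3 * w + u) * quartic r2 w
  + (u - w) ^+ 3 * quartic r1 v
  - (v - w) ^+ 2 * (3 * u - 2 * v - w) * quartic r0 u =
  (u - v) ^+ 2 * (v - w) * (u - w) * hermite_deriv r0 r1 r2 s u a b.
Proof.
move=> v w al be ka.
(* Both sides are linear in the Taylor coefficients and remainders jointly, so the two kinds of
   terms are checked separately; only the remainders bring quotients. *)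
have poly_part : (v - w) ^+ 2 * (u - w) * (u - v) * quartic_deriv 0 u
  - (u - v) ^+ 2 * (2 * v - 3 * w + u) * quartic 0 w
  + (u - w) ^+ 3 * quartic 0 v
  - (v - w) ^+ 2 * (3 * u - 2 * v - w) * quartic 0 u =
  (u - v) ^+ 2 * (v - w) * (u - w) *
  (c1 + 2 * c2 * w + 3 * c3 * w ^+ 2
   + c4 * (4 * w ^+ 3 - (w - u) ^+ 2 * (w - v))).
  by rewrite /quartic /quartic_deriv; ring.
have rem_part : (v - w) ^+ 2 * (u - w) * (u - v) * (u ^+ 3 * s)
  - (u - v) ^+ 2 * (2 * v - 3 * w + u) * (w ^+ 4 * r2)
  + (u - w) ^+ 3 * (v ^+ 4 * r1)
  - (v - w) ^+ 2 * (3 * u - 2 * v - w) * (u ^+ 4 * r0) =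
  (u - v) ^+ 2 * (v - w) * (u - w) *
  (v * u ^+ 2 * hermite_rem r0 r1 r2 s u a b).
  by rewrite /hermite_rem /w /v; field; rewrite al be ka.
have quarticE r t : quartic r t = quartic 0 t + t ^+ 4 * r.
  by rewrite /quartic; ring.
have quartic_derivE : quartic_deriv s u = quartic_deriv 0 u + u ^+ 3 * s.
  by rewrite /quartic_deriv; ring.
rewrite !(quarticE r0) !(quarticE r1) !(quarticE r2) quartic_derivE.
rewrite /hermite_deriv -/v -/w.
have -> : u ^+ 2 * v * (1 - u ^+ 3 * a * b) ^+ 2 * (1 - u ^+ 2 * b) =
  - (w - u) ^+ 2 * (w - v) by rewrite /w /v; ring.
rewrite mulNr [RHS]mulrDr -rem_part -poly_part.
by ring.
Qed.

(** Once [c1 * w] cancels in $wH - f(z)$, each term contains $w^2$ or $w v u^2$, and both are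
    multiples of $u^8 a^2 b$. *)
Lemma hermite_stepE (r0 r1 r2 s u a b : F) :
  let w := u ^+ 2 * a * (u ^+ 2 * b) in
  let H := hermite_deriv r0 r1 r2 s u a b in
  H != 0 ->
  w - quartic r2 w / H =
  u ^+ 8 * (a ^+ 2 * b * hermite_coef r0 r1 r2 s u a b / H).
Proof.
move=> w H H0; apply: (mulIf H0); rewrite mulrBl divfK //.
rewrite -[RHS]mulrA (divfK H0) /H /hermite_deriv /hermite_coef /quartic.
move: (hermite_rem _ _ _ _ _ _ _) => S; rewrite /w.
by ring.
Qed.

End PointwiseIdentities.

Lemma lin_cvg_eq {R : realType} (g : R -> R) (l m : R) :
  lin_cvg g l -> l = m -> lin_cvg g m.
Proof. by move=> ? <-. Qed.

(** Follows the syntax of the function and builds its limit as an existential variable, which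
    [lin_cvg_eq] then compares with the simplified value. Each inverse leaves the goal that its
    limit is nonzero. *)
Ltac lin_cvg_struct :=
  lazymatch goal with
  | |- lin_cvg (fun=> ?c) _ => refine (lin_cvg_cst c)
  | |- lin_cvg (fun u => u) _ => refine lin_cvg_id
  | |- lin_cvg (fun u => - @?g u) _ => refine (lin_cvgN g _ _); lin_cvg_struct
  | |- lin_cvg (fun u => @?g u + @?h u) _ =>
      refine (lin_cvgD g h _ _ _ _); lin_cvg_struct
  | |- lin_cvg (fun u => @?g u * @?h u) _ =>
      refine (lin_cvgM g h _ _ _ _); lin_cvg_struct
  | |- lin_cvg (fun u => @?g u ^+ ?n) _ =>
      refine (lin_cvgX g _ n _); lin_cvg_struct
  | |- lin_cvg (fun u => (@?g u)^-1) _ =>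
      refine (lin_cvgV g _ _ _); [|lin_cvg_struct]
  | _ => eassumption
  end.

(** * The errors of y, z and the next iterate *)

Section LocalAnalysis.
Context {R : realType}.
Variables (D : set R) (f : R -> R) (gamma c1 c2 c3 c4 : R) (rho sigma : R -> R).
Hypothesis c1_neq0 : c1 != 0.
Hypothesis rho0 : lin_cvg rho 0.
Hypothesis sigma0 : lin_cvg sigma 0.
Hypothesis fE : \forall u \near (0 : R),
  f (gamma + u) = quartic c1 c2 c3 c4 (rho u) u.
Hypothesis dfE : \forall u \near (0 : R),
  derive1 f (gamma + u) = quartic_deriv c1 c2 c3 c4 (sigma u) u.
Hypothesis D_gamma : \forall u \near (0 : R), D (gamma + u).

(** The pointwise identities are instantiated along [u], with the remainder of f taken at the three
    errors [u], [v u] and [w u]. *)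
Let df u := quartic_deriv c1 c2 c3 c4 (sigma u) u.
Let a u := newton_coef c1 c2 c3 c4 (rho u) (sigma u) u.
Let v u := u ^+ 2 * a u.
Let den u := ostrowski_denom c1 c2 c3 c4 (rho u) (rho (v u)) (sigma u) u (a u).
Let b u := ostrowski_coef c1 c2 c3 c4 (rho u) (rho (v u)) (sigma u) u (a u).
Let w u := v u * (u ^+ 2 * b u).
Let H u := hermite_deriv c1 c2 c3 c4
  (rho u) (rho (v u)) (rho (w u)) (sigma u) u (a u) (b u).
Let E u := hermite_coef c2 c3 c4
  (rho u) (rho (v u)) (rho (w u)) (sigma u) u (a u) (b u).

Let K := (c2 ^+ 2 / c1 - c3) / c1.

Lemma lin_cvg_df : lin_cvg df c1.
Proof.
rewrite /df /quartic_deriv; eapply lin_cvg_eq; first by lin_cvg_struct.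
by ring.
Qed.

Lemma lin_cvg_a : lin_cvg a (c2 / c1).
Proof.
have dfl := lin_cvg_df.
rewrite /a /newton_coef -/(df _).
eapply lin_cvg_eq; first by lin_cvg_struct; exact: c1_neq0.
by field.
Qed.

Lemma lin_cvg_v : lin_cvg v 0.
Proof.
have al := lin_cvg_a.
rewrite /v; eapply lin_cvg_eq; first by lin_cvg_struct.
by ring.
Qed.

Lemma lin_cvg_den : lin_cvg den c1.
Proof.
have al := lin_cvg_a; have r1 := lin_cvg_comp _ _ _ rho0 lin_cvg_v.
have dfl := lin_cvg_df.
rewrite /den /ostrowski_denom /ostrowski_rem.
eapply lin_cvg_eq; first lin_cvg_struct.
  by rewrite mul0r add0r oppr_eq0 oner_eq0.
by field.
Qed.

Lemma lin_cvg_b : lin_cvg b K.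
Proof.
have al := lin_cvg_a; have r1 := lin_cvg_comp _ _ _ rho0 lin_cvg_v.
have denl := lin_cvg_den.
rewrite /b /ostrowski_coef /ostrowski_rem -/(den _).
eapply lin_cvg_eq; first lin_cvg_struct.
- by rewrite mul0r add0r oppr_eq0 oner_eq0.
- exact: c1_neq0.
by rewrite /K; field.
Qed.

Lemma lin_cvg_w : lin_cvg w 0.
Proof.
have vl := lin_cvg_v; have bl := lin_cvg_b.
rewrite /w; eapply lin_cvg_eq; first by lin_cvg_struct.
by ring.
Qed.

(** Every summand carries a Taylor remainder, which tends to 0, and all five denominators tend to
    1. *)
Lemma lin_cvg_hermite_rem : lin_cvg (fun u => hermite_rem
  (rho u) (rho (v u)) (rho (w u)) (sigma u) u (a u) (b u)) 0.
Proof.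
have al := lin_cvg_a; have bl := lin_cvg_b; have vl := lin_cvg_v.
have r1 := lin_cvg_comp _ _ _ rho0 vl.
have r2 := lin_cvg_comp _ _ _ rho0 lin_cvg_w.
rewrite /hermite_rem.
eapply lin_cvg_eq; first lin_cvg_struct.
1-5: by rewrite !(exprS, expr0, mul0r, subr0, mulr1) oner_neq0.
by rewrite !(exprS, expr0, mul0r, mulr0, addr0, subr0).
Qed.

Lemma lin_cvg_H : lin_cvg H c1.
Proof.
have al := lin_cvg_a; have bl := lin_cvg_b; have vl := lin_cvg_v.
have reml := lin_cvg_hermite_rem.
rewrite /H /hermite_deriv.
eapply lin_cvg_eq; first lin_cvg_struct.
by ring.
Qed.

Lemma lin_cvg_E : lin_cvg E (c2 * K + c4).
Proof.
have al := lin_cvg_a; have bl := lin_cvg_b; have vl := lin_cvg_v.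
have r2 := lin_cvg_comp _ _ _ rho0 lin_cvg_w.
have reml := lin_cvg_hermite_rem.
rewrite /E /hermite_coef.
eapply lin_cvg_eq; first lin_cvg_struct.
by ring.
Qed.

Let G u := a u ^+ 2 * b u * E u / H u.

(** This is the error constant in factored form: its long bracket equals
    $-(c_2^2-c_1c_3)(c_2^3-c_1c_2c_3+c_1^2c_4)$. *)
Lemma lin_cvg_G : lin_cvg G ((c2 / c1) ^+ 2 * K * (c2 * K + c4) / c1).
Proof.
have al := lin_cvg_a; have bl := lin_cvg_b; have El := lin_cvg_E.
have Hl := lin_cvg_H.
by rewrite /G; lin_cvg_struct.
Qed.

Lemma near_y_of : \forall u \near (0 : R),
  derive1 f (gamma + u) != 0 /\ y_of f (gamma + u) = gamma + v u.
Proof.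
near=> u.
have df0 : df u != 0.
  by near: u; exact: lin_cvg_neq0 lin_cvg_df c1_neq0.
have fu : f (gamma + u) = quartic c1 c2 c3 c4 (rho u) u by near: u.
have dfu : derive1 f (gamma + u) = df u by near: u.
by rewrite /y_of dfu fu -addrA newton_stepE.
Unshelve. all: by end_near. Qed.

Let fgamma : f gamma = 0.
Proof.
have := nbhs_singleton fE.
by rewrite addr0 /quartic !expr0n !(mulr0, mul0r) !addr0.
Qed.

Let near_ua : \forall u \near (0 : R), 1 - u * a u != 0.
Proof.
have al := lin_cvg_a.
apply: (@lin_cvg_neq0 _ _ 1); last exact: oner_neq0.
by eapply lin_cvg_eq; [lin_cvg_struct|ring].
Qed.

Let near_fv : \forall u \near (0 : R),
  f (gamma + v u) = quartic c1 c2 c3 c4 (rho (v u)) (v u).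
Proof. exact: (lin_cvg_cvg _ _ lin_cvg_v _ fE). Qed.

Let near_fw : \forall u \near (0 : R),
  f (gamma + w u) = quartic c1 c2 c3 c4 (rho (w u)) (w u).
Proof. exact: (lin_cvg_cvg _ _ lin_cvg_w _ fE). Qed.

Lemma near_z_of : \forall u \near (0 : R),
  (u != 0 -> z_denom f (gamma + u) (gamma + v u) != 0) /\
  z_of f (gamma + u) = gamma + w u.
Proof.
near=> u.
have [dfu0 yu] : derive1 f (gamma + u) != 0 /\ y_of f (gamma + u) = gamma + v u.
  by near: u; exact: near_y_of.
have den0 : den u != 0.
  by near: u; exact: lin_cvg_neq0 lin_cvg_den c1_neq0.
have ua : 1 - u * a u != 0 by near: u; exact: near_ua.
have fu : f (gamma + u) = quartic c1 c2 c3 c4 (rho u) u by near: u.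
have dfu : derive1 f (gamma + u) = df u by near: u.
have fv : f (gamma + v u) = quartic c1 c2 c3 c4 (rho (v u)) (v u).
  by near: u; exact: near_fv.
have denE : u != 0 -> z_denom f (gamma + u) (gamma + v u) = den u.
  move=> u0; rewrite /z_denom fv fu dfu.
  have -> : gamma + v u - (gamma + u) = v u - u by ring.
  by rewrite ostrowski_denomE // -oppr_eq0 opprB.
split; first by move=> u0; rewrite denE.
(* At [u = 0] the divided difference is 0 / 0, but f(y) = 0 makes the correction vanish whatever the
   denominator. *)
rewrite /z_of yu; have [u0|u0] := eqVneq u 0.
  by rewrite /w /v u0 expr0n !mul0r !addr0 fgamma mul0r subr0.
by rewrite denE // fv -addrA ostrowski_stepE.
Unshelve. all: by end_near. Qed.

Lemma near_step : \forall u \near (0 : R),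
  step_well_defined D f (gamma + u) /\
  step f (gamma + u) = gamma + u ^+ 8 * G u.
Proof.
have near_ub : \forall u \near (0 : R), 1 - u ^+ 2 * b u != 0.
  have bl := lin_cvg_b.
  apply: (@lin_cvg_neq0 _ _ 1); last exact: oner_neq0.
  by eapply lin_cvg_eq; [lin_cvg_struct|ring].
have near_uab : \forall u \near (0 : R), 1 - u ^+ 3 * a u * b u != 0.
  have al := lin_cvg_a; have bl := lin_cvg_b.
  apply: (@lin_cvg_neq0 _ _ 1); last exact: oner_neq0.
  by eapply lin_cvg_eq; [lin_cvg_struct|ring].
near=> u.
have [dfu0 yu] : derive1 f (gamma + u) != 0 /\ y_of f (gamma + u) = gamma + v u.
  by near: u; exact: near_y_of.
have [denu zu] : (u != 0 -> z_denom f (gamma + u) (gamma + v u) != 0) /\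
    z_of f (gamma + u) = gamma + w u.
  by near: u; exact: near_z_of.
have H0 : H u != 0 by near: u; exact: lin_cvg_neq0 lin_cvg_H c1_neq0.
have ua : 1 - u * a u != 0 by near: u; exact: near_ua.
have ub : 1 - u ^+ 2 * b u != 0 by near: u.
have uab : 1 - u ^+ 3 * a u * b u != 0 by near: u.
have fu : f (gamma + u) = quartic c1 c2 c3 c4 (rho u) u by near: u.
have dfu : derive1 f (gamma + u) = df u by near: u.
have fv : f (gamma + v u) = quartic c1 c2 c3 c4 (rho (v u)) (v u).
  by near: u; exact: near_fv.
have fw : f (gamma + w u) = quartic c1 c2 c3 c4 (rho (w u)) (w u).
  by near: u; exact: near_fw.
have Du : D (gamma + u) by near: u.
have Dv : D (gamma + v u).
  by near: u; exact: (lin_cvg_cvg _ _ lin_cvg_v _ D_gamma).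
have Dw : D (gamma + w u).
  by near: u; exact: (lin_cvg_cvg _ _ lin_cvg_w _ D_gamma).
(* These factorizations show that the three points are distinct as soon as [u] and [v u] are
   nonzero. *)
have uvE : u - v u = u * (1 - u * a u) by rewrite /v; ring.
have vwE : v u - w u = v u * (1 - u ^+ 2 * b u) by rewrite /w; ring.
have uwE : u - w u = u * (1 - u ^+ 3 * a u * b u) by rewrite /w /v; ring.
have subE s t : gamma + s - (gamma + t) = s - t by ring.
have BE : B_of f (gamma + u) (gamma + v u) (gamma + w u) =
    (u - v u) ^+ 2 * (v u - w u) * (u - w u) * H u.
  rewrite /B_of fu fv fw dfu !subE -hermite_denomE //.
  have -> : 2 * (gamma + v u) - 3 * (gamma + w u) + (gamma + u) =
    2 * v u - 3 * w u + u by ring.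
  have -> : 3 * (gamma + u) - 2 * (gamma + v u) - (gamma + w u) =
    3 * u - 2 * v u - w u by ring.
  by [].
have P0 : u != 0 -> v u != 0 -> (u - v u) ^+ 2 * (v u - w u) * (u - w u) != 0.
  move=> u0; rewrite uvE vwE uwE; move: (v u) => t t0.
  by rewrite !mulf_neq0.
have B0 : u != 0 -> v u != 0 -> B_of f (gamma + u) (gamma + v u) (gamma + w u) != 0.
  by move=> u0 v0; rewrite BE mulf_neq0 // P0.
have f_neq0 : f (gamma + u) != 0 -> u != 0.
  by apply: contra_neq => ->; rewrite addr0.
split.
  rewrite /step_well_defined yu zu; split => //.
    move=> /f_neq0 u0; split; last exact: denu.
    by rewrite subE -oppr_eq0 opprB uvE mulf_neq0.
  move=> /f_neq0 u0 fv0; apply: B0 => //.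
  by apply: contra_neq fv0 => ->; rewrite addr0.
rewrite /step yu zu.
have [u0|u0] := eqVneq u 0.
  by rewrite /w /v u0 !expr0n !mul0r !addr0 fgamma mulr0 mul0r subr0.
(* Here y is already the zero, so total division leaves z and the next iterate there; [G u] vanishes
   too, through its factor [a u ^+ 2]. *)
have [v0|v0] := eqVneq (v u) 0.
  have a0 : a u = 0.
    by move/eqP: v0; rewrite /v mulf_eq0 expf_eq0 (negbTE u0) andbF => /eqP.
  rewrite /w v0 mul0r addr0 fgamma mulr0 mul0r subr0.
  by rewrite /G a0 expr0n !mul0r mulr0 addr0.
rewrite BE !subE.
(* The node differences cancel between numerator and B, which leaves the Newton-like step with slope
   [H u]. *)
rewrite -mulf_div divff ?P0 // mul1r -addrA fw.
by rewrite hermite_stepE.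
Unshelve. all: by end_near. Qed.

End LocalAnalysis.

(** * The iteration *)

Section Iteration.
Context {R : realType}.
Variables (x : nat -> R) (gamma L : R) (G : R -> R).
Local Notation e n := (x n - gamma).
Hypothesis GL : lin_cvg G L.
Hypothesis eS : forall n, e n.+1 = e n ^+ 8 * G (e n).
Hypothesis eG : forall n, `|e n ^+ 7 * G (e n)| <= 2^-1.

(** Splitting the recursion as [e n] times [e n ^+ 7 * G (e n)] shows that the error at least halves
    at each step. *)
Let e0 : e n @[n --> \oo] --> 0.
Proof.
have e_le n : `|e n| <= `|e 0%N| * 2^-1 ^+ n.
  elim: n => [|n IHn]; first by rewrite expr0 mulr1.
  by rewrite eS exprSr mulrAC normrM [_ ^+ n.+1]exprS mulrCA ler_pM.
apply/norm_cvg0P; apply: (@squeeze_cvgr _ _ _ _ (fun=> 0)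
  (geometric `|e 0%N| 2^-1)).
- by near=> n; rewrite normr_ge0 e_le.
- exact: cvg_cst.
- apply: cvg_geometric; rewrite ger0_norm ?invr_ge0 //.
  by rewrite invf_lt1 // ltr1n.
Unshelve. all: by end_near. Qed.

Lemma iteration_cvg : x @ \oo --> gamma.
Proof. exact/subr_cvg0. Qed.

Lemma iteration_bigO :
  (fun n => x n.+1 - gamma) =
  (fun n => L * (x n - gamma) ^+ 8) +O_ \oo (fun n => (x n - gamma) ^+ 9).
Proof.
have [M M0 GM] := lin_cvg_ge0 _ _ GL.
apply/eqaddOP/bigO_exP; exists (M + 1); first by rewrite ltr_wpDl.
near=> n.
have Ge : `|G (e n) - L| <= M * `|e n| by near: n; exact: (e0 _ GM).
have -> : (fun k => x k.+1 - gamma) - (fun k => L * (x k - gamma) ^+ 8) =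
    (fun k => (G (e k) - L) * e k ^+ 8).
  apply/funext => k; transitivity (e k.+1 - L * e k ^+ 8); first by [].
  by rewrite eS mulrBl [G _ * _]mulrC.
rewrite normrM [e n ^+ 9]exprS [`|e n * e n ^+ 8|]normrM mulrA.
by rewrite ler_wpM2r // (le_trans Ge) // ler_wpM2r // lerDl.
Unshelve. all: by end_near. Qed.

(** For nonzero errors the quotient is exactly [|G (e n)|], so the asymptotic constant is [|L|]. *)
Lemma iteration_order : L != 0 -> (forall n, e n != 0) ->
  has_convergence_order x gamma 8.
Proof.
move=> L0 en0; split; first exact: iteration_cvg.
exists `|L|; split; first by rewrite normr_eq0.
have -> : (fun n => `|x n.+1 - gamma| / `|x n - gamma| `^ 8) =
    (fun n => `|G (e n)|).
  apply/funext => n; rewrite powR_mulrn // eS.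
  by rewrite -normrX -normfV -normrM mulrAC divff ?mul1r // expf_neq0.
apply: cvg_norm.
exact: cvg_comp e0 (lin_cvg_cvg _ _ GL).
Qed.

End Iteration.

(** * Error equation and convergence for a differentiable function *)

Lemma local_error_equation {R : realType} (D : set R) (f : R -> R) (gamma : R) :
  open D -> D gamma -> differentiable_times 9 D f -> simple_zero f gamma ->
  exists2 G, lin_cvg G (error_constant f gamma) & \forall u \near (0 : R),
    step_well_defined D f (gamma + u) /\
    step f (gamma + u) = gamma + u ^+ 8 * G u.
Proof.
move=> Dop Dg fd [fg0 dfg0].
have nearD : \forall x \near gamma, D x by exact: open_nbhs_nbhs.
have fder j : (j < 9)%N -> \forall x \near gamma, derivable (derive1n j f) x 1.
  by move=> j9; apply: filterS nearD => x Dx; exact: fd.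
pose c := taylor_coef f gamma.
have c1_neq0 : c 1%N != 0.
  by rewrite /c /taylor_coef derive1n1 divr1.
have c0 : c 0%N = 0 by rewrite /c /taylor_coef derive1n0 fg0 mul0r.
(* Index 3 gives degree 4 with remainder [u ^+ 4 * rho u]; index 2 for f' below gives degree 3 with
   [u ^+ 3 * sigma u]. *)
have [|rho rho0 fE] := @taylor_expansion _ 3 f gamma.
  by move=> j j4; apply: fder; rewrite (leq_ltn_trans j4).
have [|sigma sigma0 dfE] := @taylor_expansion _ 2 (derive1 f) gamma.
  move=> j j3; rewrite -derive1Sn; apply: fder.
  by rewrite ltnS (leq_ltn_trans j3).
have {}fE : \forall u \near (0 : R),
    f (gamma + u) = quartic (c 1%N) (c 2%N) (c 3%N) (c 4%N) (rho u) u.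
  apply: filterS fE => u ->; rewrite horner_poly !big_ord_recl big_ord0 /=.
  rewrite -!/(c _) c0 /quartic /bump /=.
  by ring.
have {}dfE : \forall u \near (0 : R), derive1 f (gamma + u) =
    quartic_deriv (c 1%N) (c 2%N) (c 3%N) (c 4%N) (sigma u) u.
  apply: filterS dfE => u ->; rewrite horner_poly !big_ord_recl big_ord0 /=.
  rewrite !taylor_coef_derive1 -!/(c _) /quartic_deriv /bump /=.
  by ring.
have D0 : \forall u \near (0 : R), D (gamma + u) by move/nbhs0P: nearD.
have GL := @lin_cvg_G _ _ (c 2%N) (c 3%N) (c 4%N) _ _ c1_neq0 rho0 sigma0.
eexists; last exact: near_step c1_neq0 rho0 sigma0 fE dfE D0.
apply: (lin_cvg_eq _ _ _ GL).
rewrite /error_constant -!/(c _).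
by field.
Qed.

Theorem theorem3 (R : realType) (D : set R) (f : R -> R) (gamma : R)
    (D_open : open D) (D_interval : is_interval D) (D_gamma : D gamma)
    (f_diff : differentiable_times 9 D f)
    (f_gamma : simple_zero f gamma) :
  (fun x : R => step f x - gamma) =
    (fun x : R => error_constant f gamma * (x - gamma) ^+ 8)
      +O_ (nbhs gamma) (fun x : R => (x - gamma) ^+ 9)
  /\
  exists delta : R, 0 < delta /\
    forall x0 : R, `|x0 - gamma| < delta ->
      [/\ forall n : nat, step_well_defined D f (iterate f x0 n),
          iterate f x0 @ \oo --> gamma,
          (fun n : nat => iterate f x0 n.+1 - gamma) =
            (fun n : nat =>
               error_constant f gamma * (iterate f x0 n - gamma) ^+ 8)
              +O_ \oo (fun n : nat => (iterate f x0 n - gamma) ^+ 9)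
        & x0 != gamma -> error_constant f gamma != 0 ->
          has_convergence_order (iterate f x0) gamma 8].
Proof.
have [G GL stepE] := local_error_equation _ _ _ D_open D_gamma f_diff f_gamma.
move: (error_constant f gamma) GL => L GL.
split.
  have [M M0 GM] := lin_cvg_ge0 _ _ GL.
  apply/eqaddOP/bigO_exP; exists (M + 1); first by rewrite ltr_wpDl.
  apply: (nbhs0P _ gamma).2; near=> u.
  have Gu : `|G u - L| <= M * `|u| by near: u.
  have [_ su] : step_well_defined D f (gamma + u) /\
    step f (gamma + u) = gamma + u ^+ 8 * G u by near: u.
  rewrite (_ : (_ - _) (gamma + u) = (G u - L) * u ^+ 8).
    rewrite [gamma + u - gamma]addrAC subrr add0r normrM.
    rewrite [u ^+ 9]exprS [`|u * u ^+ 8|]normrM mulrA.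
    by rewrite ler_wpM2r // (le_trans Gu) // ler_wpM2r // lerDl.
  transitivity (step f (gamma + u) - gamma - L * (gamma + u - gamma) ^+ 8) => //.
  by rewrite su; ring.
(* The factor by which one step multiplies the error; making it at most 1/2 gives contraction. *)
have u7G : \forall u \near (0 : R), `|u ^+ 7 * G u| <= 2^-1.
  have : lin_cvg (fun u => u ^+ 7 * G u) (0 ^+ 7 * L) by lin_cvg_struct.
  by rewrite exprS !mul0r => /lin_cvg_cvg/cvgr0_norm_le; apply; rewrite invr_gt0.
(* Keeping [L != 0] as a premise lets one radius serve both the degenerate and the nondegenerate
   case. *)
have GN0 : \forall u \near (0 : R), L != 0 -> G u != 0.
  have [L0|L0] := eqVneq L 0; first by exists 1 => //= u _; rewrite L0 eqxx.
  by apply: filterS (lin_cvg_neq0 _ _ GL L0).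
have [d /= d0 dP] : nbhs (0 : R) [set u | [/\ step_well_defined D f (gamma + u),
    step f (gamma + u) = gamma + u ^+ 8 * G u, `|u ^+ 7 * G u| <= 2^-1 &
    L != 0 -> G u != 0]].
  near=> u.
  have [? ?] : step_well_defined D f (gamma + u) /\
    step f (gamma + u) = gamma + u ^+ 8 * G u by near: u.
  by split => //; near: u.
exists d; split => // x0 x0d.
pose e n := iterate f x0 n - gamma.
have itE n : iterate f x0 n = gamma + e n by rewrite /e addrC subrK.
(* The ball is invariant because errors do not grow, so the local facts hold along the whole
   orbit. *)
have de n : `|e n| < d.
  elim: n => [//|n IHn].
  have [|_ sE uG _] := dP (e n); first by rewrite /ball /= sub0r normrN.
  rewrite /e /iterate iterS -/(iterate f x0 n) itE sE addrC addKr.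
  rewrite exprSr mulrAC normrM (le_lt_trans _ IHn) // ler_piMl //.
  by rewrite (le_trans uG) // invf_le1 // ler1n.
have eP n : [/\ step_well_defined D f (gamma + e n),
    step f (gamma + e n) = gamma + e n ^+ 8 * G (e n),
    `|e n ^+ 7 * G (e n)| <= 2^-1 & L != 0 -> G (e n) != 0].
  by apply: dP; rewrite /ball /= sub0r normrN.
have eS n : e n.+1 = e n ^+ 8 * G (e n).
  have [_ sE _ _] := eP n; rewrite [LHS]/e /iterate iterS -/(iterate f x0 n).
  by rewrite [X in step f X]itE sE addrC addKr.
have eG n : `|e n ^+ 7 * G (e n)| <= 2^-1 by have [] := eP n.
split.
- by move=> n; rewrite itE; have [] := eP n.
- exact: iteration_cvg _ _ _ eS eG.
- exact: iteration_bigO _ _ _ _ GL eS eG.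
(* No iterate reaches [gamma]: both [e n] and [G (e n)] stay nonzero, so the quotients defining the
   order are genuine. *)
move=> x0g L0; apply: (iteration_order _ _ _ _ GL eS eG L0) => n.
elim: n => [|n IHn]; first by rewrite subr_eq0.
rewrite -/(e _) eS mulf_neq0 ?expf_neq0 //.
by have [_ _ _] := eP n; apply.
Unshelve. all: by end_near. Qed.
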